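(* Let $(\tau_K,E,D)$ be a symmetric-key quantum encryption scheme that is non-malleable (NM). Then $(\tau_K,E,D)$ satisfies information-theoretic secrecy (ITS).
   Context: All Hilbert spaces are finite-dimensional; $\log$ is base 2; $H$ is the von Neumann entropy, $I(X:Y)=H(X)+H(Y)-H(XY)$, $h$ the binary entropy. $|\phi^+\rangle_{CC'}=|C|^{-1/2}\sum_i|i\rangle|i\rangle$ is the standard maximally entangled vector and $\phi^+=|\phi^+\rangle\langle\phi^+|$; a tensor factor on which a map is not specified to act carries the identity. A symmetric-key quantum encryption scheme (QES) is a triple $(\tau_K,E,D)$ of the uniform classical key state $\tau_K=\frac1{|K|}\sum_k|k\rangle\langle k|$ and channels (CPTP maps) $E:\mathrm{End}(\mathcal H_A\otimes\mathcal H_K)\to\mathrm{End}(\mathcal H_C\otimes\mathcal H_K)$, $D:\mathrm{End}(\mathcal H_C\otimes\mathcal H_K)\to\mathrm{End}((\mathcal H_A\oplus\mathbb C|\bot\rangle)\otimes\mathcal H_K)$ (key register unchanged) with $(D\circ E)(X\otimes|k\rangle\langle k|)=(X\oplus0_\bot)\otimes|k\rangle\langle k|$ for all $k$. The output space $\mathcal H_A\oplus\mathbb C|\bot\rangle$ of $D$ is, by slight abuse, also denoted $A$. ITS: for any $\mathcal H_B$ and any state $\rho_{AB}$, the state $\sigma_{CBK}=E(\rho_{AB}\otimes\tau_K)$ satisfies $I(C:B)_\sigma=0$. For an attack, i.e. a CPTP map $\Lambda_{CB\to C\tilde B}$, the effective channel is $\tilde\Lambda_{AB\to A\tilde B}=\mathrm{tr}_K\big[(D\circ\Lambda\circ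 E)((\cdot)\otimes\tau_K)\big]$, and $p_=(\Lambda,\rho)=\mathrm{tr}\big[(\phi^+_{CC'}\otimes 1_{\tilde B})\Lambda(\phi^+_{CC'}\otimes\rho_B)\big]$. NM: for any state $\rho_{ABR}$ and any CPTP map $\Lambda_{CB\to C\tilde B}$, $I(AR:\tilde B)_{\tilde\Lambda(\rho)}\le I(AR:B)_\rho+h(p_=(\Lambda,\rho))$. *)

(* Defs.v *)
From HB Require Import structures.
From mathcomp Require Import all_boot all_order all_algebra.
From mathcomp Require Import sesquilinear spectral complex.
From mathcomp Require Import reals exp.

Set Implicit Arguments.
Unset Strict Implicit.
Unset Printing Implicit Defensive.

Import Order.TTheory GRing.Theory Num.Theory.
Local Open Scope ring_scope.
Local Open Scope complex_scope.
Local Open Scope sesquilinear_scope.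

(* A register, i.e. a finite-dimensional Hilbert space with a fixed orthonormal
   basis, is given by the finType [T] labelling that basis.  The tensor product
   of registers is the product of finTypes, and adjoining one orthogonal
   dimension C|bot> is [option], with [None] labelling |bot>. *)
Notation op R T := 'M[R[i]]_#|{: T}|.

Section Operators.
Variable R : realType.
Implicit Types K S T U V : finType.

Definition ent T (X : op R T) (s t : T) : R[i] := X (enum_rank s) (enum_rank t).

Definition mkop T (f : T -> T -> R[i]) : op R T :=
  \matrix_(i, j) f (enum_val i) (enum_val j).

Definition psd T (X : op R T) : Prop :=
  forall v : 'rV[R[i]]_#|T|, 0 <= (v *m X *m v^t*) 0 0.

Definition state T (X : op R T) : Prop := psd X /\ \tr X = 1.

Definition proj T (t : T) : op R T := delta_mx (enum_rank t) (enum_rank t).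

Definition tens S T (X : op R S) (Y : op R T) : op R (S * T) :=
  mkop (fun p q => ent X p.1 q.1 * ent Y p.2 q.2).

(* [ptr1] and [ptr2] trace out the first, resp. second, tensor factor. *)
Definition ptr1 S T (X : op R (S * T)) : op R T :=
  mkop (fun t t' => \sum_(s : S) ent X (s, t) (s, t')).

Definition ptr2 S T (X : op R (S * T)) : op R S :=
  mkop (fun s s' => \sum_(t : T) ent X (s, t) (s', t)).

(* S (x) T (x) U seen as S (x) U (x) T. *)
Definition swap23 S T U (X : op R (S * T * U)) : op R (S * U * T) :=
  mkop (fun p q => ent X (p.1.1, p.2, p.1.2) (q.1.1, q.2, q.1.2)).

Definition oplus0 T (X : op R T) : op R (option T) :=
  mkop (fun s t => if (s, t) is (Some s', Some t') then ent X s' t' else 0).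

(* [ext U f] is f (x) id_U: f is applied to each of the blocks
   (1 (x) <u|) X (1 (x) |u'>) of X. *)
Definition ext U S T (f : op R S -> op R T) (X : op R (S * U)) : op R (T * U) :=
  mkop (fun p q =>
    ent (f (mkop (fun s s' => ent X (s, p.2) (s', q.2)))) p.1 q.1).

Definition completely_positive S T (f : op R S -> op R T) : Prop :=
  forall (U : finType) (X : op R (S * U)), psd X -> psd (ext f X).

Definition trace_preserving S T (f : op R S -> op R T) : Prop :=
  forall X : op R S, \tr (f X) = \tr X.

Definition cptp S T (f : {linear op R S -> op R T}) : Prop :=
  completely_positive f /\ trace_preserving f.

Definition log2 (x : R) : R := ln x / ln 2.

(* [spectral_diag X] lists the eigenvalues of the Hermitian X, with
   multiplicity; [ln 0 = 0], so null eigenvalues contribute 0. *)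
Definition entropy T (X : op R T) : R :=
  - \sum_i (let l := complex.Re (spectral_diag X 0 i) in l * log2 l).

Definition mutual_info S T (X : op R (S * T)) : R :=
  entropy (ptr2 X) + entropy (ptr1 X) - entropy X.

Definition binary_entropy (p : R) : R :=
  - (p * log2 p) - (1 - p) * log2 (1 - p).

Definition max_ent_vec T : 'cV[R[i]]_#|{: T * T}| :=
  \col_i (let p := enum_val i in
          (sqrtC (#|T|%:R : R[i]))^-1 * (p.1 == p.2)%:R).

Definition max_ent T : op R (T * T) := max_ent_vec T *m (max_ent_vec T)^t*.

Definition uniform_key K : op R K := #|K|%:R^-1 *: \sum_(k : K) proj k.

End Operators.

(* The key register is unchanged by both channels; [enc_key] follows from
   [dec_key], [decK] and the two channels being CPTP. *)
Record qes (R : realType) (A C K : finType) := QES {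
  enc : {linear op R (A * K) -> op R (C * K)};
  dec : {linear op R (C * K) -> op R (option A * K)};
  key_gt0 : (0 < #|K|)%N;
  enc_cptp : cptp enc;
  dec_cptp : cptp dec;
  enc_key : forall (k : K) (X : op R A),
    exists Y : op R C, enc (tens X (proj R k)) = tens Y (proj R k);
  dec_key : forall (k : K) (Y : op R C),
    exists X : op R (option A), dec (tens Y (proj R k)) = tens X (proj R k);
  decK : forall (k : K) (X : op R A),
    dec (enc (tens X (proj R k))) = tens (oplus0 X) (proj R k) }.

Section Security.
Variables (R : realType) (A C K : finType) (Q : qes R A C K).

(* E (X_AB (x) tau_K), with registers ordered C, B, K. *)
Definition encrypt (B : finType) (X : op R (A * B)) : op R (C * B * K) :=
  swap23 (ext (enc Q) (swap23 (tens X (uniform_key R K)))).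

Definition ITS : Prop :=
  forall (B : finType) (rho : op R (A * B)), state rho ->
    mutual_info (ptr2 (encrypt rho)) = 0.

Definition effective (B B' : finType)
    (L : {linear op R (C * B) -> op R (C * B')}) (X : op R (A * B)) :
    op R (option A * B') :=
  ptr2 (swap23 (ext (dec Q) (swap23 (ext L (encrypt X))))).

(* The real number p_=(L, rho), as a function of the marginal rhoB of rho;
   registers are ordered C, B, C' before L, and C, C', B' under the trace. *)
Definition p_eq (B B' : finType)
    (L : {linear op R (C * B) -> op R (C * B')}) (rhoB : op R B) : R :=
  complex.Re (\tr (tens (max_ent R C) (1%:M : op R B') *m
                   swap23 (ext L (swap23 (tens (max_ent R C) rhoB))))).

(* [rho] has registers A, B, R, the last one being labelled by [U]. *)
Definition NM : Prop :=
  forall (B B' U : finType) (rho : op R (A * B * U))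
         (L : {linear op R (C * B) -> op R (C * B')}),
    state rho -> cptp L ->
    mutual_info (swap23 (ext (effective L) rho)) <=
    mutual_info (swap23 rho) + binary_entropy (p_eq L (ptr1 (ptr2 rho))).

End Security.

(* Main.v *)
Require Import Defs.
From HB Require Import structures.
From mathcomp Require Import all_boot all_order all_algebra.
From mathcomp Require Import reals.
From mathcomp Require Import sesquilinear spectral complex exp ring lra.

(** Consider the attack, without side information, given by the isometry
    V = (n - 1/n)^(-1/2) sum_(s,t) K_(s,t) (x) |s,t>, where n = |C| >= 2 and
    K_(s,t) = |s><t| - (1/n) delta_(s,t) 1.  The K_(s,t) are traceless, hence
    p_= = 0 and NM, with B trivial, forces I(AR : B~) <= 0 for the output
    state.  By the equality case of Klein's inequality that state is a product,
    and it remains one after tracing out A, which yields what V leaks about the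
    ciphertext register of sigma_(CR).  The leaked operators
    K_(s',t')^* K_(s,t) span all operators on C: for s <> t, the choices
    (s',t') = (s,t) and (s',t') = (s,s) give |t><t| and (1 - 1/n) |s><t|.
    Therefore sigma_(CR) itself is a product.  For n <= 1 there is nothing to
    leak. *)

Set Implicit Arguments.
Unset Strict Implicit.
Unset Printing Implicit Defensive.

Import Order.TTheory GRing.Theory Num.Theory.
Local Open Scope ring_scope.
Local Open Scope sesquilinear_scope.

(** * Unitary diagonalisation *)

Section Unitary.
Variables (C : numClosedFieldType) (n : nat).
Implicit Types (X P Q : 'M[C]_n) (a b : 'rV[C]_n).

Lemma unitaryMV P : P \is unitarymx -> P *m P^t* = 1%:M.
Proof. by move/unitarymxP. Qed.

Lemma unitaryVM P : P \is unitarymx -> P^t* *m P = 1%:M.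
Proof. by move=> uP; apply: mulmx1C; apply/unitarymxP. Qed.

Lemma unitary_overlap P Q :
  P \is unitarymx -> Q \is unitarymx -> P *m Q^t* \is unitarymx.
Proof. by move=> uP uQ; rewrite mul_unitarymx ?trmxC_unitary. Qed.

(* Two diagonalisations describe the same operator iff only equal eigenvalues
   have overlapping eigenvectors; weighted by the squared overlaps, which are
   doubly stochastic, this replaces uniqueness of the spectrum below. *)
Lemma conj_diag_eqP P Q a b : P \is unitarymx -> Q \is unitarymx ->
  P^t* *m diag_mx a *m P = Q^t* *m diag_mx b *m Q <->
  (forall i j, (P *m Q^t*) i j != 0 -> a 0 i = b 0 j).
Proof.
move=> uP uQ.
(* Equality means that the overlap matrix [W] intertwines the two diagonal matrices; entrywise this
   reads [a_i W_ij = W_ij b_j]. *)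
have eqW : P^t* *m diag_mx a *m P = Q^t* *m diag_mx b *m Q <->
    diag_mx a *m (P *m Q^t*) = (P *m Q^t*) *m diag_mx b.
  split=> h.
    move/(congr1 (fun X => P *m X *m Q^t*)): h.
    by rewrite !mulmxA unitaryMV // mul1mx => ->;
      rewrite -!mulmxA unitaryMV // mulmx1.
  move/(congr1 (fun X => P^t* *m X *m Q)): h.
  by rewrite !mulmxA unitaryVM // mul1mx => <-;
    rewrite -!mulmxA unitaryVM // mulmx1.
rewrite eqW; move: (P *m Q^t*) => W; rewrite mul_diag_mx mul_mx_diag;
  split=> [h i j W0|h].
  by have /matrixP/(_ i j) := h; rewrite !mxE mulrC => /(mulfI W0).
apply/matrixP => i j; rewrite !mxE mulrC.
by have [->|/h ->] := eqVneq (W i j) 0; rewrite ?mul0r.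
Qed.

Lemma conj_overlap P Q a : Q *m (P^t* *m diag_mx a *m P) *m Q^t* =
  (P *m Q^t*)^t* *m diag_mx a *m (P *m Q^t*).
Proof. by rewrite trmx_mul map_mxM trmxCK !mulmxA. Qed.

Lemma conj_diag_normal P a : P \is unitarymx -> P^t* *m diag_mx a *m P \is normalmx.
Proof.
move=> uP; apply/orthomx_spectral_subproof; exists (P, a) => //=.
by rewrite invmx_unitary.
Qed.

Lemma normal_spectral X : X \is normalmx ->
  X = (spectralmx X)^t* *m diag_mx (spectral_diag X) *m spectralmx X.
Proof. by move=> /orthomx_spectralP {1}->;
  rewrite invmx_unitary ?spectral_unitarymx. Qed.

Lemma trace_conj_diag P a : P \is unitarymx ->
  \tr (P^t* *m diag_mx a *m P) = \sum_i a 0 i.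
Proof. by move=> uP; rewrite mxtrace_mulC mulmxA unitaryMV // mul1mx
  mxtrace_diag. Qed.

Lemma trace_conj_diagM P a b : P \is unitarymx ->
  \tr (P^t* *m diag_mx a *m P *m (P^t* *m diag_mx b *m P)) = \sum_i a 0 i * b 0 i.
Proof.
move=> uP; rewrite !mulmxA -[_ *m P *m P^t*]mulmxA unitaryMV // mulmx1 mxtrace_mulC.
rewrite !mulmxA unitaryMV // mul1mx mul_diag_mx.
by apply: eq_bigr => i _; rewrite !mxE eqxx mulr1n.
Qed.

Lemma pos_form_hermitian X :
  (forall v : 'rV[C]_n, 0 <= (v *m X *m v^t*) 0 0) -> X^t* = X.
Proof.
move=> pX; (* Polarisation along e_i + e_j and e_i + i e_j. *)
have rX (u : 'rV_n) : (u *m X *m u^t*) 0 0 = ((u *m X *m u^t*) 0 0)^*.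
  by apply/esym/CrealP/ger0_real/pX.
have expand z i j (u := delta_mx 0 i + z *: delta_mx 0 j : 'rV[C]_n) :
    (u *m X *m u^t*) 0 0 = X i i + z^* * X i j + z * X j i + z * z^* * X j j.
  have e k l (x := delta_mx 0 k : 'rV[C]_n) (y := delta_mx 0 l : 'rV[C]_n) :
      x *m X *m y^t* = (X k l)%:M.
    apply/matrixP => i1 j1.
    rewrite !ord1 -rowE !mxE eqxx mulr1n (bigD1 l) //= big1 ?addr0.
      by rewrite !mxE !eqxx conjC1 mulr1.
    by move=> m /negbTE ml; rewrite !mxE ml andbF conjC0 mulr0.
  have -> : u^t* = (delta_mx 0 i : 'rV_n)^t* + z^* *: (delta_mx 0 j : 'rV_n)^t*.
    by apply/matrixP => k l; rewrite !mxE rmorphD rmorphM.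
  rewrite !mulmxDl !mulmxDr -!scalemxAl -!scalemxAr.
  by rewrite !e !mxE eqxx !mulr1n; ring.
apply/matrixP => i j; rewrite !mxE.
have rd k : (X k k)^* = X k k.
  by have := rX (delta_mx 0 k + 0 *: delta_mx 0 k);
    rewrite expand conjC0 !mul0r !addr0 => <-.
have h1 := rX (delta_mx 0 i + 1 *: delta_mx 0 j).
have h2 := rX (delta_mx 0 i + 'i *: delta_mx 0 j).
move: h1 h2; rewrite !expand !rmorphD !rmorphM /= !conjCK conjC1 conjCi !rd =>
  h1 h2.
(* [h3] says that [X j i + X i j] is real, [h4] that [X j i - X i j] is imaginary; subtracting them
   gives twice the wanted identity. *)
have h3 : X j i + X i j - ((X j i)^* + (X i j)^*) = 0.
  by move/eqP: h1; rewrite -subr_eq0 => /eqP <-; ring.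
have h4 : X j i - X i j - ((X i j)^* - (X j i)^*) = 0.
  apply: (mulfI (neq0Ci C)); rewrite mulr0.
  by move/eqP: h2; rewrite -subr_eq0 => /eqP <-; ring.
have n2 : (2 : C) != 0 by rewrite pnatr_eq0.
apply: (mulfI n2); apply/eqP; rewrite -subr_eq0; apply/eqP.
by have := congr2 (fun x y => y - x) h3 h4; rewrite subr0 => <-; ring.
Qed.

Lemma pos_form_spectral X : (forall v : 'rV[C]_n, 0 <= (v *m X *m v^t*) 0 0) ->
  exists (P : 'M[C]_n) (d : 'rV[C]_n), [/\ P \is unitarymx, forall i,
    0 <= d 0 i & X = P^t* *m diag_mx d *m P].
Proof.
move=> pX; have uP := spectral_unitarymx X.
have /normal_spectral : X \is normalmx by apply/normalmxP;
  rewrite pos_form_hermitian.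
move: (spectralmx X) (spectral_diag X) uP => P d uP XE.
exists P, d; split=> // i; have := pX (row i P); congr (0 <= _).
transitivity ((P *m X *m P^t*) i i).
  by rewrite -row_mul !mxE; apply: eq_bigr => k _; rewrite !mxE.
rewrite XE !mulmxA unitaryMV // mul1mx -mulmxA unitaryMV // mulmx1.
by rewrite !mxE eqxx mulr1n.
Qed.
End Unitary.

Local Open Scope complex_scope.

(** * Operators and completely positive maps *)

Lemma sum_enum_rank (V : nmodType) (T : finType) (F : 'I_#|T| -> V) :
  \sum_i F i = \sum_(t : T) F (enum_rank t).
Proof.
rewrite (reindex (@enum_rank T)) //=.
by exists enum_val => i _; rewrite (enum_rankK, enum_valK).
Qed.

Lemma sum_prod (V : nmodType) (S T : finType) (F : S * T -> V) :
  \sum_p F p = \sum_s \sum_t F (s, t).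
Proof. by rewrite pair_big; apply: eq_bigr => -[]. Qed.

Lemma sum_delta (R : pzSemiRingType) (T : finType) (t0 : T) (F : T -> R) :
  \sum_t F t * (t0 == t)%:R = F t0.
Proof.
rewrite (bigD1 t0) //= eqxx mulr1 big1 ?addr0 // => t /negbTE.
by rewrite eq_sym => ->; rewrite mulr0.
Qed.

Section Ops.
Variable R : realType.
Implicit Types S T U V : finType.

Lemma entE T (f : T -> T -> R[i]) s t : ent (mkop f) s t = f s t.
Proof. by rewrite /ent mxE !enum_rankK. Qed.

Lemma op_ext T (X Y : op R T) : (forall s t, ent X s t = ent Y s t) -> X = Y.
Proof.
move=> eqXY; apply/matrixP => i j.
by have := eqXY (enum_val i) (enum_val j); rewrite /ent !enum_valK.
Qed.

Lemma entZ T a (X : op R T) s t : ent (a *: X) s t = a * ent X s t.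
Proof. by rewrite /ent mxE. Qed.

Lemma ent_sum T I (r : seq I) (P : pred I) (F : I -> op R T) s t :
  ent (\sum_(i <- r | P i) F i) s t = \sum_(i <- r | P i) ent (F i) s t.
Proof. by rewrite /ent summxE. Qed.

Lemma entM T (X Y : op R T) s t :
  ent (X *m Y) s t = \sum_u ent X s u * ent Y u t.
Proof. by rewrite /ent mxE sum_enum_rank. Qed.

Lemma ent_adj T (X : op R T) s t : ent (X^t*) s t = (ent X t s)^*%R.
Proof. by rewrite /ent !mxE. Qed.

Lemma ent1 T s t : ent (1%:M : op R T) s t = (s == t)%:R.
Proof. by rewrite /ent !mxE (inj_eq enum_rank_inj). Qed.

Lemma ent_proj T (u s t : T) : ent (proj R u) s t = ((s == u) && (t == u))%:R.
Proof. by rewrite /ent !mxE !(inj_eq enum_rank_inj). Qed.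

Lemma ent_uniform_key T (s t : T) :
  ent (uniform_key R T) s t = #|T|%:R^-1 * (s == t)%:R.
Proof.
rewrite entZ ent_sum; congr (_ * _).
under eq_bigr do rewrite ent_proj.
rewrite -[RHS](sum_delta s (fun u => (u == t)%:R)); apply: eq_bigr => u _.
by rewrite -natrM mulnb andbC [t == u]eq_sym.
Qed.

Lemma trE T (X : op R T) : \tr X = \sum_t ent X t t.
Proof. by rewrite /mxtrace sum_enum_rank. Qed.

Lemma psd_sum S I (r : seq I) (P : pred I) (F : I -> op R S) :
  (forall i, psd (F i)) -> psd (\sum_(i <- r | P i) F i).
Proof.
move=> pF v; rewrite mulmx_sumr mulmx_suml summxE.
by apply: sumr_ge0 => i _; apply: pF.
Qed.

Lemma psdZ S (X : op R S) a : 0 <= a -> psd X -> psd (a *: X).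
Proof. by move=> a0 pX v; rewrite -scalemxAr -scalemxAl mxE mulr_ge0. Qed.

Definition kernel_mx S T (k : T -> S -> R[i]) : 'M[R[i]]_(#|T|, #|S|) :=
  \matrix_(i, j) k (enum_val i) (enum_val j).

(** The completely positive map with the single Kraus operator [kernel_mx k]. *)
Definition congruence S T (k : T -> S -> R[i]) (X : op R S) : op R T :=
  kernel_mx k *m X *m (kernel_mx k)^t*.

Lemma ent_congruence S T (k : T -> S -> R[i]) X t t' :
  ent (congruence k X) t t' =
  \sum_s \sum_s' k t s * ent X s s' * (k t' s')^*%R.
Proof.
rewrite /ent mxE sum_enum_rank exchange_big; apply: eq_bigr => s _.
rewrite !mxE sum_enum_rank mulr_suml; apply: eq_bigr => s' _.
by rewrite !mxE !enum_rankK.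
Qed.

Lemma psd_congruence S T (k : T -> S -> R[i]) X : psd X -> psd (congruence k X).
Proof.
by move=> pX v; have := pX (v *m kernel_mx k); rewrite trmx_mul map_mxM !mulmxA.
Qed.

Fact congruence_is_linear S T (k : T -> S -> R[i]) : linear (congruence k).
Proof.
by move=> a X Y; rewrite /congruence mulmxDr mulmxDl -scalemxAr -scalemxAl.
Qed.

HB.instance Definition _ S T (k : T -> S -> R[i]) :=
  GRing.isLinear.Build _ _ _ _ (congruence k) (congruence_is_linear k).

(** Congruence by the 0/1 matrix of an arbitrary map [h]. Permuting or re-bracketing tensor factors,
    adjoining a trivial one and cutting out a diagonal block all have this form, so [psd_relabel]
    covers their positivity. *)
Definition relabel S T (h : T -> S) (X : op R S) : op R T :=
  mkop (fun s t => ent X (h s) (h t)).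

Lemma psd_relabel S T (h : T -> S) (X : op R S) : psd X -> psd (relabel h X).
Proof.
move=> /(@psd_congruence _ _ (fun t s => (h t == s)%:R)); congr psd.
apply: op_ext => t t'; rewrite entE ent_congruence.
rewrite -(sum_delta (h t) (fun s => ent X s (h t'))); apply: eq_bigr => s _.
rewrite -(sum_delta (h t') (fun s' => ent X s s')) mulr_suml.
by apply: eq_bigr => s' _; rewrite conjC_nat -mulrA mulrC.
Qed.

Lemma psd_tens_key S T (X : op R S) : psd X -> psd (tens X (uniform_key R T)).
Proof.
move=> pX.
(* Adjoining the uniform key is the mixture over [k] of the isometries sending |s> to |s,k>. *)
have -> : tens X (uniform_key R T) = \sum_(k : T) #|T|%:R^-1 *:
   congruence (fun p s => (k == p.2)%:R * (p.1 == s)%:R) X.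
  apply: op_ext => -[s k] [s' k']; rewrite entE ent_uniform_key ent_sum /=.
  rewrite mulrCA -(sum_delta k (fun u => (u == k')%:R)) !mulr_sumr.
  apply: eq_bigr => u _.
  rewrite entZ ent_congruence; congr (_ * _).
  rewrite -(sum_delta s (fun x => ent X x s')) mulr_suml; apply: eq_bigr => x _.
  rewrite -(sum_delta s' (fun x' => ent X x x')) !mulr_suml.
  apply: eq_bigr => x' _ /=.
  rewrite rmorphM /= !conjC_nat [u == k]eq_sym.
  ring.
by apply: psd_sum => k; apply: psdZ; rewrite ?invr_ge0 ?ler0n//;
  apply: psd_congruence.
Qed.

(** * Complete positivity of the maps that make up the scheme *)

Lemma completely_positive_comp S T U (f : op R S -> op R T) (g : op R T -> op R U) :
  completely_positive f -> completely_positive g -> completely_positive (g \o f).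
Proof.
move=> cf cg V X /cf/cg; congr psd; apply: op_ext => p q; rewrite !entE /=.
congr (ent (g _) _ _); apply: op_ext => t t'; rewrite !entE /=.
by [].
Qed.

(** Positivity is the case of the trivial ancilla [unit], up to relabelling. *)
Lemma completely_positive_psd S T (f : op R S -> op R T) X :
  completely_positive f -> psd X -> psd (f X).
Proof.
move=> cf pX; have /cf := @psd_relabel _ (S * unit)%type fst X pX.
move=> /(@psd_relabel _ T (fun t => (t, tt))); congr psd.
apply: op_ext => t t'; rewrite !entE /=; congr (ent (f _) _ _).
by apply: op_ext => s s'; rewrite !entE.
Qed.

(** Two successive ancillas [V] and [U] amount to the single ancilla [V * U]; only the bracketing
    changes. *)
Lemma completely_positive_ext V S T (f : op R S -> op R T) :
  completely_positive f -> completely_positive (@ext _ V _ _ f).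
Proof.
move=> cf U X /(@psd_relabel _ (S * (V * U))%type (fun p => (p.1, p.2.1, p.2.2))).
move=> /cf /(@psd_relabel _ (T * V * U)%type (fun p => (p.1.1, (p.1.2, p.2)))).
congr psd; apply: op_ext => -[[t v] u] [[t' v'] u']; rewrite !entE /=.
by congr (ent (f _) _ _); apply: op_ext => s s'; rewrite !entE.
Qed.

Lemma completely_positive_swap23 S T U : completely_positive (@swap23 R S T U).
Proof.
move=> V X /(@psd_relabel _ (S * U * T * V)%type
  (fun p => ((p.1.1.1, p.1.2, p.1.1.2), p.2))).
by congr psd; apply: op_ext => p q; rewrite !entE.
Qed.

Lemma psd_ptr2 S T (X : op R (S * T)) : psd X -> psd (ptr2 X).
Proof.
move=> pX; have -> : ptr2 X = \sum_t relabel (fun s => (s, t)) X.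
  apply: op_ext => s s'; rewrite entE ent_sum.
  by apply: eq_bigr => t _; rewrite entE.
by apply: psd_sum => t; apply: psd_relabel.
Qed.

Lemma psd_ptr1 S T (X : op R (S * T)) : psd X -> psd (ptr1 X).
Proof.
move=> pX; have -> : ptr1 X = \sum_s relabel (fun t => (s, t)) X.
  apply: op_ext => t t'; rewrite entE ent_sum.
  by apply: eq_bigr => s _; rewrite entE.
by apply: psd_sum => s; apply: psd_relabel.
Qed.

Lemma completely_positive_ptr2 S T : completely_positive (@ptr2 R S T).
Proof.
move=> V X /(@psd_relabel _ (S * V * T)%type
  (fun p => (p.1.1, p.2, p.1.2))) /psd_ptr2.
congr psd; apply: op_ext => p q; rewrite !entE.
by apply: eq_bigr => t _; rewrite !entE.
Qed.

Lemma completely_positive_tens_key S T :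
  completely_positive (fun X : op R S => tens X (uniform_key R T)).
Proof.
move=> V X /(@psd_tens_key _ T) /(@psd_relabel _ (S * T * V)%type
  (fun p => (p.1.1, p.2, p.1.2))).
by congr psd; apply: op_ext => p q; rewrite !entE.
Qed.

(** An ancilla turns the Kraus operator k into k (x) 1, so the extended map is again a
    congruence. *)
Lemma completely_positive_congruence S T (k : T -> S -> R[i]) :
  completely_positive (congruence k).
Proof.
move=> U X /(@psd_congruence _ (T * U)%type
  (fun p q => k p.1 q.1 * (p.2 == q.2)%:R)).
congr psd; apply: op_ext => -[t u] [t' u'].
rewrite entE !ent_congruence sum_prod; apply: eq_bigr => s _ /=.
under eq_bigr => u1 _ do rewrite sum_prod.
rewrite exchange_big /=; apply: eq_bigr => s' _.
rewrite entE /= -(sum_delta u (fun x => k t s * ent X (s, x) (s',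
  u') * (k t' s')^*%R)).
apply: eq_bigr => x _.
rewrite -(sum_delta u' (fun x' => k t s * ent X (s, x) (s', x') * (k t' s')^*%R)).
rewrite mulr_suml; apply: eq_bigr => x' _.
rewrite rmorphM /= conjC_nat.
ring.
Qed.

(** * Trace preservation *)

Lemma trace_ext U S T (f : op R S -> op R T) :
  trace_preserving f -> trace_preserving (@ext _ U _ _ f).
Proof.
move=> tf X; rewrite !trE !sum_prod exchange_big [RHS]exchange_big.
apply: eq_bigr => u _; under eq_bigr do rewrite entE /=.
by rewrite -trE tf trE; apply: eq_bigr => s _; rewrite entE.
Qed.

Lemma trace_swap23 S T U : trace_preserving (@swap23 R S T U).
Proof.
move=> X; rewrite !trE !sum_prod; apply: eq_bigr => s _.
by rewrite exchange_big; do 2!apply: eq_bigr => ? _; rewrite entE.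
Qed.

Lemma trace_ptr2 S T : trace_preserving (@ptr2 R S T).
Proof. by move=> X; rewrite !trE sum_prod; apply: eq_bigr => s _; rewrite entE. Qed.

Lemma trace_ptr1 S T : trace_preserving (@ptr1 R S T).
Proof.
move=> X; rewrite !trE sum_prod exchange_big; apply: eq_bigr => s _.
by rewrite entE.
Qed.

Lemma trace_tens S T (X : op R S) (Y : op R T) :
  \tr (tens X Y) = \tr X * \tr Y.
Proof.
rewrite !trE sum_prod mulr_suml; apply: eq_bigr => s _.
by rewrite mulr_sumr; apply: eq_bigr => t _; rewrite entE.
Qed.

Lemma trace_uniform_key T : (0 < #|T|)%N -> \tr (uniform_key R T) = 1.
Proof.
move=> T0; rewrite trE; under eq_bigr do rewrite ent_uniform_key eqxx mulr1.
by rewrite sumr_const cardT -cardE -[_ *+ _]mulr_natr mulVf // pnatr_eq0 -lt0n.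
Qed.
End Ops.

(** * Entropy and mutual information *)

Section Gibbs.
Variable R : realType.

(** Strictness away from 1 is what yields the equality case of [gibbs_term]. *)
Lemma ln_lt_subr1 (x : R) : 0 < x -> x != 1 -> ln x < x - 1.
Proof.
move=> x0 x1; have /expR_gt1Dx : ln x != 0 by rewrite ln_eq0.
by rewrite lnK ?posrE// => ?; lra.
Qed.

(* x ln (y/x) <= y - x; multiplied out so as to hold at x = 0. *)
Lemma gibbs_term (x y : R) : 0 <= x -> 0 < y ->
  x - y <= x * ln x - x * ln y ?= iff (x == y).
Proof.
rewrite le_eqVlt => /orP[/eqP<- y0|x0 y0].
  apply/leifP; rewrite (lt_eqF y0); lra.
have [->|xy] := eqVneq x y; first by apply/leifP; rewrite !subrr.
apply/leifP; have yx1 : y / x != 1.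
  by apply: contra xy => /eqP h; rewrite -[y](divfK (lt0r_neq0 x0)) h mul1r.
have := ln_lt_subr1 (divr_gt0 y0 x0) yx1.
rewrite ln_div ?posrE // -(ltr_pM2l x0) !mulrBr mulr1 mulrCA divff ?lt0r_neq0//.
by rewrite mulr1 => ?; lra.
Qed.

(** The equality case of Klein's inequality in scalar form. Summing the slack of [gibbs_term] with
    weights [w], double stochasticity and the equal totals cancel the linear terms, so the sum of
    nonnegative terms is at most 0 and each of them vanishes. *)
Lemma gibbs_eq (I J : finType) (w : I -> J -> R) (a : I -> R) (b : J -> R) :
  (forall i j, 0 <= w i j) ->
  (forall i, \sum_j w i j = 1) -> (forall j, \sum_i w i j = 1) ->
  (forall i, 0 <= a i) -> (forall j, 0 <= b j) ->
  \sum_i a i = \sum_j b j ->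
  (forall i j, b j = 0 -> w i j * a i = 0) ->
  \sum_i a i * ln (a i) <= \sum_i \sum_j w i j * a i * ln (b j) ->
  forall i j, w i j != 0 -> a i = b j.
Proof.
move=> w0 w1 w2 a0 b0 ab supp H.
pose g i j := w i j * (a i * ln (a i) - a i * ln (b j) - (a i - b j)).
have g0 i j : 0 <= g i j.
  (* At [b j = 0] the convention [ln 0 = 0] would spoil the inequality; the support hypothesis makes
     the whole term zero there. *)
  have [/eqP bj|bj] := boolP (b j == 0).
    have /eqP := supp i j bj; rewrite /g bj mulf_eq0 => /orP[]/eqP->;
      first by rewrite mul0r.
    by rewrite !mul0r !subr0 mulr0.
  have bj0 : 0 < b j by rewrite lt_neqAle eq_sym bj b0.
  by rewrite mulr_ge0 // subr_ge0 (gibbs_term (a0 i) bj0).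
have sg : \sum_i \sum_j g i j <= 0.
  have -> : \sum_i \sum_j g i j = \sum_i a i * ln (a i)
      - \sum_i \sum_j w i j * a i * ln (b j) - (\sum_i a i - \sum_j b j).
    have -> : \sum_j b j = \sum_i \sum_j w i j * b j.
      rewrite exchange_big; apply: eq_bigr => j _.
      by rewrite -mulr_suml w2 mul1r.
    rewrite -!sumrB; apply: eq_bigr => i _.
    transitivity (\sum_j (w i j * (a i * ln (a i)) - w i j * a i * ln (b j)
      - (w i j * a i - w i j * b j))).
      by apply: eq_bigr => j _; rewrite /g; ring.
    by rewrite !sumrB -!mulr_suml w1 !mul1r.
  by rewrite ab subrr subr0 subr_le0.
move=> i j wij.
have gij : g i j = 0.
  have h : \sum_i \sum_j g i j == 0.
    by rewrite eq_le sg sumr_ge0 // => ? _; apply: sumr_ge0.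
  move: h; rewrite psumr_eq0 => [/allP/(_ i (mem_index_enum i))|? _];
    last exact: sumr_ge0.
  by rewrite psumr_eq0 => // /allP/(_ j (mem_index_enum j))/eqP.
have [/eqP bj|bj] := boolP (b j == 0).
  by have /eqP := supp i j bj; rewrite mulf_eq0 (negbTE wij) bj => /eqP.
have bj0 : 0 < b j by rewrite lt_neqAle eq_sym bj b0.
move/eqP: gij; rewrite mulf_eq0 (negbTE wij) /= subr_eq0 eq_sym.
by rewrite (gibbs_term (a0 i) bj0) => /eqP.
Qed.
End Gibbs.

(** * Spectra, and the entropy of tensor products *)

Section Spectral.
Variable R : realType.
Implicit Types S T U V : finType.

(** The squared modulus, valued in [R] so that squared overlaps can serve as the real weights of
    [gibbs_eq]. *)
Definition nsq (z : R[i]) : R := complex.Re z ^+ 2 + complex.Im z ^+ 2.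

Lemma nsqE z : (nsq z)%:C = z * z^*%R.
Proof. by rewrite add_Re2_Im2 normCK. Qed.

Lemma nsq_ge0 z : 0 <= nsq z.
Proof. by rewrite addr_ge0 // sqr_ge0. Qed.

Lemma nsq_eq0 z : (nsq z == 0) = (z == 0).
Proof. by rewrite -(inj_eq (@complexI R)) nsqE mul_conjC_eq0. Qed.

(** Indexed by basis labels instead of ordinals, so that the spectrum of a tensor product is a
    function of pairs. *)
Definition diag_op T (a : T -> R[i]) : op R T := diag_mx (\row_i a (enum_val i)).

Lemma ent_diag_op T (a : T -> R[i]) s t : ent (diag_op a) s t = a s * (s == t)%:R.
Proof. by rewrite /ent !mxE enum_rankK (inj_eq enum_rank_inj) mulr_natr. Qed.

Lemma sum_nsq_row T (W : op R T) s : W \is unitarymx -> \sum_t nsq (ent W s t) = 1.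
Proof.
move/unitaryMV/(congr1 (fun X : op R T => ent X s s)).
rewrite entM ent1 eqxx mulr1n => h; apply: (@complexI R);
  rewrite rmorph_sum rmorph1 -h /=.
by apply: eq_bigr => t _; rewrite nsqE ent_adj.
Qed.

Lemma sum_nsq_col T (W : op R T) t : W \is unitarymx -> \sum_s nsq (ent W s t) = 1.
Proof.
move/unitaryVM/(congr1 (fun X : op R T => ent X t t)).
rewrite entM ent1 eqxx mulr1n => h; apply: (@complexI R);
  rewrite rmorph_sum rmorph1 -h /=.
by apply: eq_bigr => s _; rewrite nsqE ent_adj mulrC.
Qed.

Lemma conj_diag_op_eqP T (P Q : op R T) (a b : T -> R[i]) :
  P \is unitarymx -> Q \is unitarymx ->
  P^t* *m diag_op a *m P = Q^t* *m diag_op b *m Q <->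
  (forall s t, ent (P *m Q^t*) s t != 0 -> a s = b t).
Proof.
move=> uP uQ; have := conj_diag_eqP (\row_i a (enum_val i)) (\row_i b (enum_val
  i)) uP uQ.
rewrite -/(diag_op a) -/(diag_op b) /ent => ->; split=> h.
  by move=> s t /h; rewrite !mxE !enum_rankK.
by move=> i j W0; rewrite !mxE; apply: h; rewrite !enum_valK.
Qed.

Lemma diag_op_spectral_diag T (X : op R T) :
  diag_mx (spectral_diag X) = diag_op (fun t => spectral_diag X 0 (enum_rank t)).
Proof. by congr diag_mx; apply/rowP => i; rewrite mxE enum_valK. Qed.

Lemma psd_spectral T (X : op R T) : psd X -> exists (P : op R T) (a : T -> R),
  [/\ P \is unitarymx, forall t, 0 <= a t & X =
    P^t* *m diag_op (fun t => (a t)%:C) *m P].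
Proof.
move=> /pos_form_spectral[P [d [uP d0 XE]]].
exists P, (fun t => complex.Re (d 0 (enum_rank t))); split=> [||].
- exact: uP.
- by move=> t; have := d0 (enum_rank t); rewrite lecE => /andP[].
suff -> : diag_op (fun t => (complex.Re (d 0 (enum_rank t)))%:C) = diag_mx d by [].
by congr diag_mx; apply/rowP => i; rewrite mxE enum_valK RRe_real ?ger0_real.
Qed.

(** Any diagonalisation computes the entropy, not only the one chosen by [spectralmx]. The squared
    overlaps are inserted by their column sums, [d t] is exchanged for [a s] wherever the overlap is
    nonzero, and the overlaps disappear by their row sums. *)
Lemma entropy_spectral T (X P : op R T) (a : T -> R) :
  P \is unitarymx -> X = P^t* *m diag_op (fun t => (a t)%:C) *m P ->
  entropy X = - \sum_t a t * log2 (a t).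
Proof.
move=> uP XE; have uS := spectral_unitarymx X.
have /normal_spectral : X \is normalmx by rewrite XE;
  exact: (conj_diag_normal _ uP).
rewrite diag_op_spectral_diag {1}XE => /(conj_diag_op_eqP _ _ uP uS) eqd.
rewrite /entropy; congr (- _); rewrite sum_enum_rank.
move: (spectralmx X) uS eqd => S uS eqd.
pose d t := complex.Re (spectral_diag X 0 (enum_rank t)).
have uW := unitary_overlap uP uS.
transitivity (\sum_t \sum_s nsq (ent (P *m S^t*) s t) * (d t * log2 (d t))).
  by apply: eq_bigr => t _; rewrite -mulr_suml sum_nsq_col // mul1r.
rewrite exchange_big; apply: eq_bigr => s _ /=.
transitivity (\sum_t nsq (ent (P *m S^t*) s t) * (a s * log2 (a s))).
  apply: eq_bigr => t _; have [->|W0] := eqVneq (ent (P *m S^t*) s t) 0.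
    by rewrite (eqP (_ : nsq 0 == 0)) ?nsq_eq0 // !mul0r.
  by rewrite /d -(eqd _ _ W0).
by rewrite -mulr_suml sum_nsq_row // mul1r.
Qed.

Lemma tens_mul S T (A B : op R S) (C D : op R T) :
  tens A C *m tens B D = tens (A *m B) (C *m D).
Proof.
apply: op_ext => -[s t] [s' t']; rewrite entM entE /= !entM sum_prod mulr_suml.
apply: eq_bigr => u _; rewrite mulr_sumr; apply: eq_bigr => v _.
by rewrite !entE /= mulrACA.
Qed.

Lemma tens_adj S T (A : op R S) (B : op R T) : (tens A B)^t* = tens (A^t*) (B^t*).
Proof. by apply: op_ext => p q; rewrite entE !ent_adj !entE rmorphM. Qed.

Lemma tens11 S T : tens (1%:M : op R S) (1%:M : op R T) = 1%:M.
Proof.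
apply: op_ext => -[s t] [s' t']; rewrite entE !ent1 /= -natrM mulnb.
by rewrite xpair_eqE.
Qed.

Lemma unitary_tens S T (A : op R S) (B : op R T) :
  A \is unitarymx -> B \is unitarymx -> tens A B \is unitarymx.
Proof.
move=> uA uB; apply/unitarymxP.
by rewrite tens_adj tens_mul !unitaryMV // tens11.
Qed.

Lemma tens_diag_op S T (a : S -> R[i]) (b : T -> R[i]) :
  tens (diag_op a) (diag_op b) = diag_op (fun p => a p.1 * b p.2).
Proof.
apply: op_ext => -[s t] [s' t']; rewrite entE !ent_diag_op /= mulrACA -natrM mulnb.
by rewrite xpair_eqE.
Qed.

Lemma trace_conj_diag_op T (P : op R T) (a : T -> R[i]) : P \is unitarymx ->
  \tr (P^t* *m diag_op a *m P) = \sum_t a t.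
Proof.
move=> uP; rewrite trace_conj_diag // sum_enum_rank.
by apply: eq_bigr => t _; rewrite mxE enum_rankK.
Qed.

Lemma trace_conj_diag_opM T (P : op R T) (a f : T -> R[i]) : P \is unitarymx ->
  \tr (P^t* *m diag_op a *m P *m (P^t* *m diag_op f *m P)) = \sum_t a t * f t.
Proof.
move=> uP; rewrite trace_conj_diagM // sum_enum_rank.
by apply: eq_bigr => t _; rewrite !mxE enum_rankK.
Qed.

Lemma tens_spectral S T (P : op R S) (Q : op R T) (a : S -> R) (b : T -> R) :
  tens (P^t* *m diag_op (fun s => (a s)%:C) *m P) (Q^t* *m diag_op (fun t => (b
    t)%:C) *m Q) =
  (tens P Q)^t* *m diag_op (fun p => (a p.1 * b p.2)%:C) *m tens P Q.
Proof.
have <- : tens (diag_op (fun s => (a s)%:C)) (diag_op (fun t => (b t)%:C)) =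
    diag_op (fun p => (a p.1 * b p.2)%:C).
  by rewrite tens_diag_op; apply: op_ext => p q; rewrite !ent_diag_op rmorphM.
rewrite tens_adj tens_mul tens_mul; reflexivity.
Qed.

Lemma mul_log2M (x y : R) : 0 <= x -> 0 <= y ->
  x * y * log2 (x * y) = y * (x * log2 x) + x * (y * log2 y).
Proof.
rewrite !le_eqVlt => /orP[/eqP<-|x0] /orP[/eqP<-|y0];
  rewrite ?mul0r ?mulr0 ?mul0r ?addr0 //.
by rewrite /log2 lnM ?posrE //; ring.
Qed.

Lemma entropy_tens S T (X : op R S) (Y : op R T) : state X -> state Y ->
  entropy (tens X Y) = entropy X + entropy Y.
Proof.
move=> [/psd_spectral[P [a [uP a0 XE]]] tX] [/psd_spectral[Q [b [uQ b0 YE]]] tY].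
have sa : \sum_s a s = 1.
  by apply: (@complexI R); rewrite rmorph_sum rmorph1 -tX XE trace_conj_diag_op.
have sb : \sum_t b t = 1.
  by apply: (@complexI R); rewrite rmorph_sum rmorph1 -tY YE trace_conj_diag_op.
have XYE := tens_spectral P Q a b; rewrite -XE -YE in XYE.
rewrite (entropy_spectral (unitary_tens uP uQ) XYE).
rewrite (entropy_spectral uP XE) (entropy_spectral uQ YE) -opprD; congr (- _).
rewrite sum_prod; under eq_bigr => s _ do under eq_bigr => t _ do rewrite
  mul_log2M //.
under eq_bigr => s _ do rewrite big_split /= -mulr_suml -mulr_sumr sb mul1r.
by rewrite big_split /= -mulr_suml sa mul1r.
Qed.

Lemma ptr2_tens S T (X : op R S) (Y : op R T) : ptr2 (tens X Y) = \tr Y *: X.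
Proof.
apply: op_ext => s s'; rewrite entE entZ trE mulr_suml; apply: eq_bigr => t _.
by rewrite entE mulrC.
Qed.

Lemma ptr1_tens S T (X : op R S) (Y : op R T) : ptr1 (tens X Y) = \tr X *: Y.
Proof.
apply: op_ext => s s'; rewrite entE entZ trE mulr_suml; apply: eq_bigr => t _.
by rewrite entE.
Qed.

Lemma mutual_info_tens S T (X : op R S) (Y : op R T) : state X -> state Y ->
  mutual_info (tens X Y) = 0.
Proof.
move=> sX sY; rewrite /mutual_info ptr2_tens ptr1_tens.
by rewrite (proj2 sX) (proj2 sY) !scale1r entropy_tens // subrr.
Qed.

(** Duality between the partial trace and tensoring with the identity; it reduces expectations of
    one-sided observables to the marginals. *)
Lemma trace_tens1 S T (A : op R S) (X : op R (S * T)) :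
  \tr (X *m tens A 1%:M) = \tr (ptr2 X *m A).
Proof.
rewrite !trE sum_prod; apply: eq_bigr => s _; rewrite entM.
under eq_bigr do rewrite entM sum_prod.
rewrite exchange_big; apply: eq_bigr => s' _; rewrite entE mulr_suml.
apply: eq_bigr => t _.
rewrite -(sum_delta t (fun t' => ent X (s, t) (s', t') * ent A s' s)).
by apply: eq_bigr => t' _; rewrite entE ent1 /= [t == _]eq_sym mulrA.
Qed.

Lemma trace_1tens S T (B : op R T) (X : op R (S * T)) :
  \tr (X *m tens 1%:M B) = \tr (ptr1 X *m B).
Proof.
rewrite !trE sum_prod exchange_big; apply: eq_bigr => t _; rewrite entM.
under eq_bigr do rewrite entM sum_prod exchange_big.
rewrite exchange_big; apply: eq_bigr => t' _; rewrite entE mulr_suml.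
apply: eq_bigr => s _.
rewrite -(sum_delta s (fun s' => ent X (s, t) (s', t') * ent B t' t)).
by apply: eq_bigr => s' _; rewrite entE ent1 /= [s == _]eq_sym mulrA mulrAC.
Qed.

End Spectral.

(** * Vanishing mutual information forces a product *)

Section Klein.
Variable R : realType.
Implicit Types S T U V : finType.

Lemma ent_mul_diag_op T (a : T -> R[i]) (W : op R T) s t : ent (W *m diag_op a)
  s t = ent W s t * a t.
Proof. by rewrite /ent mul_mx_diag !mxE enum_rankK. Qed.

Lemma ent_conj_diag_op T (W : op R T) (l : T -> R[i]) t :
  ent (W^t* *m diag_op l *m W) t t = \sum_k ent W k t * (ent W k t)^*%R * l k.
Proof.
rewrite entM; apply: eq_bigr => k _.
by rewrite ent_mul_diag_op ent_adj mulrC mulrA.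
Qed.

Lemma conj_overlap_diag_op T (P Q : op R T) (a : T -> R[i]) :
  Q *m (P^t* *m diag_op a *m P) *m Q^t* =
    (P *m Q^t*)^t* *m diag_op a *m (P *m Q^t*).
Proof. exact: conj_overlap. Qed.

Lemma trace_mul_diag_op T (X : op R T) f : \tr (X *m diag_op f) =
  \sum_t ent X t t * f t.
Proof. by rewrite trE; apply: eq_bigr => t _; rewrite ent_mul_diag_op. Qed.

Section Marginals.
Variables (S T : finType) (X : op R (S * T)) (A : op R S) (B : op R T).
Hypotheses (uA : A \is unitarymx) (uB : B \is unitarymx).
Let Q := tens A B.

Lemma trace_conj_tens F G : 
  \tr (Q *m X *m Q^t* *m tens F G) =
  \tr (X *m tens (A^t* *m F *m A) (B^t* *m G *m B)).
Proof.
by rewrite -!tens_mul -tens_adj -!mulmxA mxtrace_mulC !mulmxA.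
Qed.

(** With [f] as test function: the diagonal of [X] in the product basis [Q], seen as a distribution
    on pairs, has the spectrum of [ptr2 X] as first marginal. *)
Lemma sum_diag_marginal1 (a : S -> R[i]) f : ptr2 X = A^t* *m diag_op a *m A ->
  \sum_p ent (Q *m X *m Q^t*) p p * f p.1 = \sum_s a s * f s.
Proof.
move=> XE; rewrite -(trace_mul_diag_op _ (fun p => f p.1)).
have -> : diag_op (fun p : S * T => f p.1) = tens (diag_op f) 1%:M.
  apply: op_ext => -[s t] [s' t'].
  by rewrite entE !ent_diag_op ent1 -mulrA -natrM mulnb xpair_eqE.
rewrite trace_conj_tens mulmx1 [B^t* *m B]unitaryVM; last exact: uB.
by rewrite trace_tens1 XE trace_conj_diag_opM; last exact: uA.
Qed.

Lemma sum_diag_marginal2 (b : T -> R[i]) f : ptr1 X = B^t* *m diag_op b *m B ->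
  \sum_p ent (Q *m X *m Q^t*) p p * f p.2 = \sum_t b t * f t.
Proof.
move=> XE; rewrite -(trace_mul_diag_op _ (fun p => f p.2)).
have -> : diag_op (fun p : S * T => f p.2) = tens 1%:M (diag_op f).
  apply: op_ext => -[s t] [s' t'].
  by rewrite entE !ent_diag_op ent1 mulrCA -natrM mulnb xpair_eqE.
rewrite trace_conj_tens mulmx1 [A^t* *m A]unitaryVM; last exact: uA.
by rewrite trace_1tens XE trace_conj_diag_opM; last exact: uB.
Qed.
End Marginals.

(** Mutual information is the relative entropy of [X] to the product of its marginals. [gibbs_eq]
    compares the spectrum [l] of [X] with the products [a p.1 * b p.2], weighted by the squared
    overlaps of the eigenbases. *)
Lemma mutual_info_le0 S T (X : op R (S * T)) :
  state X -> mutual_info X <= 0 -> X = tens (ptr2 X) (ptr1 X).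
Proof.
move=> [pX tX].
have [P [l [uP l0 XE]]] := psd_spectral pX.
have [A [a [uA a0 X1E]]] := psd_spectral (psd_ptr2 pX).
have [B [b [uB b0 X2E]]] := psd_spectral (psd_ptr1 pX).
rewrite /mutual_info (entropy_spectral uP XE) (entropy_spectral uA X1E).
rewrite (entropy_spectral uB X2E) => I0.
set Q := tens A B; have uQ : Q \is unitarymx by exact: (unitary_tens uA uB).
pose W := P *m Q^t*; have uW : W \is unitarymx by exact: (unitary_overlap uP uQ).
have sl : \sum_p l p = 1.
  by apply: (@complexI R); rewrite rmorph_sum rmorph1 -tX XE trace_conj_diag_op.
have sa : \sum_s a s = 1.
  by apply: (@complexI R); rewrite rmorph_sum rmorph1 -tX -trace_ptr2 X1E
    trace_conj_diag_op.
have sb : \sum_t b t = 1.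
  by apply: (@complexI R); rewrite rmorph_sum rmorph1 -tX -trace_ptr1 X2E
    trace_conj_diag_op.
(* The diagonal of [X] in the product eigenbasis of its marginals: a distribution on pairs with
   marginals [a] and [b]. *)
pose q p := \sum_k nsq (ent W k p) * l k.
have q0 p : 0 <= q p by apply: sumr_ge0 => k _; rewrite mulr_ge0 ?nsq_ge0.
have qE p : (q p)%:C = ent (Q *m X *m Q^t*) p p.
  rewrite XE conj_overlap_diag_op -/W ent_conj_diag_op rmorph_sum;
    apply: eq_bigr => k _ /=.
  by rewrite rmorphM /= nsqE.
have qf1 f : \sum_p q p * f p.1 = \sum_s a s * f s.
  apply: (@complexI R); rewrite !rmorph_sum.
  under eq_bigr do rewrite rmorphM /= qE.
  under [RHS]eq_bigr do rewrite rmorphM /=.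
  exact: (sum_diag_marginal1 uA uB (fun s => (f s)%:C) X1E).
have qf2 f : \sum_p q p * f p.2 = \sum_t b t * f t.
  apply: (@complexI R); rewrite !rmorph_sum.
  under eq_bigr do rewrite rmorphM /= qE.
  under [RHS]eq_bigr do rewrite rmorphM /=.
  exact: (sum_diag_marginal2 uA uB (fun s => (f s)%:C) X2E).
have qle1 p : q p <= a p.1.
  rewrite -(sum_delta p.1 a) -(qf1 (fun s => (p.1 == s)%:R)) (bigD1 p) //= eqxx
    mulr1 lerDl.
  by apply: sumr_ge0 => k _; rewrite mulr_ge0 ?ler0n.
have qle2 p : q p <= b p.2.
  rewrite -(sum_delta p.2 b) -(qf2 (fun s => (p.2 == s)%:R)) (bigD1 p) //= eqxx
    mulr1 lerDl.
  by apply: sumr_ge0 => k _; rewrite mulr_ge0 ?ler0n.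
(* The support condition of [gibbs_eq]: [q] is bounded by each of its marginals, so it vanishes
   wherever one of them does. *)
have qab p : a p.1 * b p.2 = 0 -> q p = 0.
  move=> /eqP; rewrite mulf_eq0 => ab0; apply/eqP; rewrite eq_le q0 andbT.
  by case/orP: ab0 => /eqP z; [have := qle1 p | have := qle2 p]; rewrite z.
have wl0 k p : 0 <= nsq (ent W k p) * l k by rewrite mulr_ge0 ?nsq_ge0.
have key i j : nsq (ent W i j) != 0 -> l i = a j.1 * b j.2.
  move: i j; apply: (@gibbs_eq _ _ _ (fun k p => nsq (ent W k p)) l (fun p => a
    p.1 * b p.2)).
  - by move=> *; apply: nsq_ge0.
  - by move=> k; apply: sum_nsq_row.
  - by move=> k; apply: sum_nsq_col.
  - exact: l0.
  - by move=> p; rewrite mulr_ge0.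
  - rewrite sl sum_prod; under eq_bigr do rewrite /= -mulr_sumr sb mulr1.
    by rewrite sa.
  - move=> k p /qab; move/eqP; rewrite psumr_eq0 // => /allP/(_ k
    (mem_index_enum k)).
    by move/eqP.
  (* The [q]-average of [ln (a p.1 * b p.2)] splits into the two marginal sums, so [I0], up to the
     factor [ln 2], is the inequality that [gibbs_eq] asks for. *)
  have -> : \sum_k \sum_p nsq (ent W k p) * l k * ln (a p.1 * b p.2) =
     \sum_s a s * ln (a s) + \sum_t b t * ln (b t).
    rewrite exchange_big -(qf1 (fun s => ln (a s))) -(qf2 (fun s => ln (b s))).
    rewrite -big_split; apply: eq_bigr => p _ /=.
    rewrite -mulr_suml -/(q p).
    have [->|qp] := eqVneq (q p) 0; first by rewrite !mul0r addr0.
    have : a p.1 * b p.2 != 0 by apply: contraNneq qp => /qab ->.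
    rewrite mulf_eq0 negb_or => /andP[ap bp].
    by rewrite lnM ?posrE ?mulrDr // lt_neqAle eq_sym ?ap ?bp ?a0 ?b0.
  have ln2 : 0 < ln 2 :> R by rewrite ln_gt0 // ltr1n.
  move: I0; rewrite /log2.
  have e (I : finType) (f : I -> R) : \sum_k f k * (ln (f k) / ln 2) =
    (\sum_k f k * ln (f k)) / ln 2.
    by rewrite mulr_suml; apply: eq_bigr => ? _; rewrite mulrA.
  rewrite !e -!mulNr -!mulrDl pmulr_lle0 ?invr_gt0 // => h; lra.
rewrite X1E X2E tens_spectral {1}XE.
apply/(conj_diag_op_eqP _ _ uP uQ) => i j W0; congr _%:C.
by apply: key; rewrite nsq_eq0.
Qed.
End Klein.

(** * The attack *)

Lemma big_unit_type (V : nmodType) (F : unit -> V) : \sum_u F u = F tt.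
Proof. by rewrite (bigD1 tt) //= big1 ?addr0 // => -[]. Qed.

(** The factors need no normalisation: the marginals are [f] times the trace of [g] and [g] times
    the trace of [f], and the product of these two traces is [\tr X = 1]. *)
Lemma mutual_info_factor (R : realType) (S T : finType) (X : op R (S * T)) f g :
  state X ->
  (forall s t s' t', ent X (s, t) (s', t') = f s s' * g t t') -> mutual_info X = 0.
Proof.
move=> [pX tX] XE.
have -> : X = tens (ptr2 X) (ptr1 X).
  apply: op_ext => -[s t] [s' t']; rewrite !entE /=.
  under eq_bigr do rewrite XE.
  under [X in _ * X]eq_bigr do rewrite XE.
  rewrite -mulr_suml -mulr_sumr XE -[LHS]mulr1 -tX trE sum_prod.
  under [X in _ * X = _]eq_bigr do
    under eq_bigr do rewrite XE.
  under [X in _ * X = _]eq_bigr do rewrite -mulr_sumr.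
  by rewrite -mulr_suml; ring.
apply: mutual_info_tens; split.
- exact: psd_ptr2.
- by rewrite trace_ptr2.
- exact: psd_ptr1.
- by rewrite trace_ptr1.
Qed.

(** * Encryption and the effective channel *)

Section Scheme.
Variables (R : realType) (A C K : finType) (Q : qes R A C K).

Lemma completely_positive_encrypt (B : finType) :
  completely_positive (@encrypt R A C K Q B).
Proof.
have h1 := completely_positive_comp (@completely_positive_tens_key R (A * B)%type K)
  (@completely_positive_swap23 R A B K).
have h2 := completely_positive_comp h1 (@completely_positive_ext _ B _ _ _
  (proj1 (enc_cptp Q))).
exact: (completely_positive_comp h2 (@completely_positive_swap23 R C K B)).
Qed.

Lemma trace_encrypt (B : finType) : trace_preserving (@encrypt R A C K Q B).
Proof.
move=> X; rewrite /encrypt trace_swap23 trace_ext; last exact: (proj2 (enc_cptp Q)).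
by rewrite trace_swap23 trace_tens trace_uniform_key ?mulr1 // (key_gt0 Q).
Qed.

Lemma completely_positive_effective (B B' : finType)
    (L : {linear op R (C * B) -> op R (C * B')}) :
  cptp L -> completely_positive (effective Q L).
Proof.
move=> [cL _].
have h1 := completely_positive_comp (@completely_positive_encrypt B)
  (@completely_positive_ext _ K _ _ _ cL).
have h2 := completely_positive_comp h1 (@completely_positive_swap23 R C B' K).
have h3 := completely_positive_comp h2 (@completely_positive_ext _ B' _ _ _
  (proj1 (dec_cptp Q))).
have h4 := completely_positive_comp h3 (@completely_positive_swap23 R (option A)
  K B').
exact: (completely_positive_comp h4 (@completely_positive_ptr2 R (option A *
  B')%type K)).
Qed.

Lemma trace_effective (B B' : finType)
    (L : {linear op R (C * B) -> op R (C * B')}) :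
  cptp L -> trace_preserving (effective Q L).
Proof.
move=> [_ tL] X; rewrite /effective trace_ptr2 trace_swap23 trace_ext.
  by rewrite trace_swap23 trace_ext ?trace_encrypt.
exact: (proj2 (dec_cptp Q)).
Qed.

(** Encryption acts on each block of the side register separately. This lets a block indexed by a
    reference register be encrypted as an operator with trivial side information. *)
Lemma ent_ptr2_encrypt_block (B U : finType) (X : op R (A * B)) (b b' : B)
    (Y : op R (A * U)) (u u' : U) :
  (forall a a', ent Y (a, u) (a', u') = ent X (a, b) (a', b')) ->
  forall c c', ent (ptr2 (encrypt Q Y)) (c, u) (c', u') =
               ent (ptr2 (encrypt Q X)) (c, b) (c', b').
Proof.
move=> YX c c'; rewrite !entE; apply: eq_bigr => k _; rewrite !entE /=.
congr (ent (enc Q _) _ _); apply: op_ext => -[a l] [a' l'].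
by rewrite !entE /= YX.
Qed.

(** Once the plaintext, including the rejection symbol, is traced out, decryption disappears because
    it preserves the trace; what remains is the attack on the ciphertext averaged over the key. *)
Lemma sum_effective (B B' : finType) (L : {linear op R (C * B) -> op R (C * B')})
    (X : op R (A * B)) (b b' : B') :
  \sum_a ent (effective Q L X) (a, b) (a, b') =
  \sum_c ent (L (ptr2 (encrypt Q X))) (c, b) (c, b').
Proof.
(* Written as a sum of diagonal key blocks, the trace over the key passes through the linear map
   [L]. *)
have -> : ptr2 (encrypt Q X) = \sum_k
    mkop (fun s s' => ent (encrypt Q X) (s, k) (s', k)).
  apply: op_ext => s s'; rewrite entE ent_sum.
  by apply: eq_bigr => k _; rewrite entE.
under [RHS]eq_bigr do rewrite linear_sum ent_sum.
pose Y := swap23 (ext L (encrypt Q X)).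
pose Z := mkop (fun p q => ent Y (p, b) (q, b')).
transitivity (\tr (dec Q Z)).
  rewrite trE sum_prod; apply: eq_bigr => a _; rewrite entE.
  by apply: eq_bigr => k _; rewrite !entE.
rewrite (proj2 (dec_cptp Q)) trE sum_prod; apply: eq_bigr => c _.
by apply: eq_bigr => k _; rewrite !entE.
Qed.
End Scheme.

(** * The attack channel: normalisation, leakage and vanishing [p_=] *)

Section Attack.
Variables (R : realType) (C : finType).
Local Notation n := (#|C|%:R : R[i]).

(* The entry (x, (s, t)), c of V up to normalisation, i.e. <x| K_(s,t) |c>. *)
Definition leak (p : C * (C * C)) (q : C * unit) : R[i] :=
  (p.2.1 == p.1)%:R * (p.2.2 == q.1)%:R
  - n^-1 * (p.2.1 == p.2.2)%:R * (p.1 == q.1)%:R.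

Definition attack (X : op R (C * unit)) : op R (C * (C * C)) :=
  (n - n^-1)^-1 *: congruence leak X.

Fact attack_is_linear : linear attack.
Proof.
by move=> a X Y; rewrite /attack linearP scalerDr !scalerA [_ * a]mulrC.
Qed.

HB.instance Definition _ := GRing.isLinear.Build _ _ _ _ attack attack_is_linear.

Lemma conj_leak p q : (leak p q)^*%R = leak p q.
Proof. by rewrite rmorphB !rmorphM /= fmorphV /= !conjC_nat. Qed.

Lemma sum_unit (F : C * unit -> R[i]) : \sum_p F p = \sum_c F (c, tt).
Proof. by rewrite sum_prod; apply: eq_bigr => c _; rewrite big_unit_type. Qed.

Hypothesis C2 : (1 < #|C|)%N.

Lemma card_neq0 : n != 0. Proof. by rewrite pnatr_eq0 -lt0n (ltn_trans _ C2). Qed.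

Lemma card_subV_gt0 : 0 < n - n^-1.
Proof.
rewrite subr_gt0 (@lt_trans _ _ 1) ?ltr1n // invf_lt1 ?ltr1n //.
by rewrite ltr0n (ltn_trans _ C2).
Qed.

(** In the sum of all [K_(s,t)^* K_(s,t)] the parts |s><t| give n, the cross terms -2/n and the
    scalar parts 1/n, whence the normalisation n - 1/n. *)
Lemma leak_isometry q q' :
  \sum_p leak p q * (leak p q')^*%R = (n - n^-1) * (q == q')%:R.
Proof.
case: q q' => [c []] [c' []].
under eq_bigr do rewrite conj_leak.
rewrite sum_prod; under eq_bigr do rewrite sum_prod.
have -> : ((c, tt) == (c', tt)) = (c == c') by rewrite xpair_eqE andbT.
transitivity (\sum_(x : C) ((c == c')%:R - n^-1 * (x == c')%:R * (c == x)%:R));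
  last first.
  rewrite sumrB sum_delta sumr_const cardT -cardE -[(c == c')%:R *+ _]mulr_natr.
  by rewrite mulrBl [_ * n]mulrC.
apply: eq_bigr => x _; rewrite [c == x]eq_sym.
transitivity (\sum_s \sum_t
   ((t == c')%:R * (x == s)%:R * (c == t)%:R
   - n^-1 * (t == c)%:R * (x == c')%:R * (x == s)%:R * (s == t)%:R
   - n^-1 * (t == c')%:R * (x == c)%:R * (x == s)%:R * (s == t)%:R
   + n^-1 ^+ 2 * (x == c)%:R * (x == c')%:R * (s == t)%:R : R[i])).
  apply: eq_bigr => s _; apply: eq_bigr => t _.
  rewrite /leak /= [c == t]eq_sym [s == x]eq_sym.
  (* Idempotence of the 0/1 brackets is the only fact needed beyond ring identities, so they are
     generalised to plain scalars. *)
  have idem (b : bool) : b%:R * b%:R = b%:R :> R[i] by rewrite -natrM mulnb andbb.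
  have := idem (x == s); have := idem (s == t).
  move: (x == s)%:R (s == t)%:R (t == c)%:R (t == c')%:R (x == c)%:R
    (x == c')%:R n^-1.
  move=> sx st tc tc' xc xc' v st2 sx2.
  transitivity (sx * sx * tc * tc' - v * tc * xc' * sx * st - v * tc' * xc * sx * st
    + v ^+ 2 * xc * xc' * (st * st)); first by ring.
  by rewrite st2 sx2; ring.
under eq_bigr do rewrite big_split /= !sumrB !sum_delta.
rewrite big_split /= !sumrB !sum_delta sumr_const cardT -cardE.
rewrite -[(_ * _) *+ _]mulr_natr.
transitivity ((c == c')%:R - n^-1 * (x == c)%:R * (x == c')%:R * 2 +
  (n^-1 * n) * n^-1 * (x == c)%:R * (x == c')%:R : R[i]); first by ring.
by rewrite mulVf ?card_neq0 //; ring.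
Qed.

Lemma cptp_attack : cptp attack.
Proof.
split.
  move=> U X /(completely_positive_congruence leak) pX.
  have -> : ext attack X = (n - n^-1)^-1 *: ext (congruence leak) X.
    by apply: op_ext => p q; rewrite entZ !entE entZ.
  by apply: psdZ pX; rewrite invr_ge0 ltW // card_subV_gt0.
move=> X; rewrite linearZ /= trE.
under eq_bigr do rewrite ent_congruence.
rewrite exchange_big trE mulr_sumr; apply: eq_bigr => s _.
rewrite exchange_big /=.
transitivity ((n - n^-1)^-1 * \sum_s' (ent X s s' * (n - n^-1)) * (s == s')%:R).
  congr (_ * _); apply: eq_bigr => s' _.
  rewrite -mulrA -leak_isometry mulr_sumr; apply: eq_bigr => p _; ring.
by rewrite sum_delta mulrC mulfK // gt_eqF // card_subV_gt0.
Qed.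

(** For [s != t] the scalar part of [K_(s,t)] is absent and |s><t| is left: the trace over [x] then
    fixes [x = s], and the row index of [X] becomes [t]. *)
Lemma sum_attack (X : op R (C * unit)) s t b : s != t ->
  \sum_x ent (attack X) (x, (s, t)) (x, b) =
  (n - n^-1)^-1 * \sum_c ent X (t, tt) (c, tt) * leak (s, b) (c, tt).
Proof.
move=> st; under eq_bigr do rewrite entZ; rewrite -mulr_sumr; congr (_ * _).
under eq_bigr do rewrite ent_congruence.
transitivity (\sum_x (\sum_c (\sum_c' ent X (c, tt) (c', tt) * leak (x, b) (c',
  tt)) *
    (t == c)%:R) * (s == x)%:R).
  apply: eq_bigr => x _; rewrite sum_unit mulr_suml; apply: eq_bigr => c _.
  rewrite sum_unit !mulr_suml; apply: eq_bigr => c' _.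
  rewrite conj_leak {1}/leak /= (negbTE st) mulr0 mul0r subr0; ring.
by rewrite !sum_delta.
Qed.

(** |s><t| has trace 1 exactly when s = t, and then the scalar part subtracts n times 1/n. *)
Lemma trace_leak b : \sum_x leak (x, b) (x, tt) = 0.
Proof.
case: b => s t; rewrite /leak /=.
under eq_bigr do rewrite eqxx mulr1.
rewrite sumrB sumr_const cardT -cardE -[(_ * _) *+ _]mulr_natr mulrAC mulVf
  ?card_neq0 // mul1r.
under eq_bigr do rewrite mulrC.
by rewrite sum_delta eq_sym subrr.
Qed.

Lemma ent_max_ent (x x' y y' : C) : ent (max_ent R C) (x, x') (y, y') =
  (sqrtC n)^-1 * (x == x')%:R * ((sqrtC n)^-1 * (y == y')%:R)^*%R.
Proof. by rewrite /ent mxE big_ord1 !mxE !enum_rankK. Qed.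

(** The amplitude of the maximally entangled vector to stay fixed under K (x) 1 is the trace of K
    divided by n, and every [K_(s,t)] is traceless. *)
Lemma p_eq_attack rho : p_eq attack rho = 0.
Proof.
rewrite /p_eq; suff -> : \tr (tens (max_ent R C) 1%:M *m
   swap23 (ext attack (swap23 (tens (max_ent R C) rho)))) = 0 by [].
rewrite trE big1 // => -[[x x'] b] _;
  rewrite entM sum_prod exchange_big big1 // => b2 _.
rewrite sum_prod.
set a := (sqrtC n)^-1.
(* The entries are arranged so that the two deltas force [c = y' = y]; what depends on [y] is then
   [leak (y, b2) (y, tt)], whose sum is a trace. *)
have E y y' : ent (tens (max_ent R C) 1%:M) (x, x', b) (y, y', b2) *
   ent (swap23 (ext attack (swap23 (tens (max_ent R C) rho)))) (y, y', b2) (x,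
     x', b) =
   (\sum_c (leak (y, b2) (c, tt) * (a * (x == x')%:R * a^*%R * (b == b2)%:R * (n
     - n^-1)^-1 *
     \sum_c' (a * (a * (c' == x')%:R)^*%R * ent rho tt tt * leak (x, b) (c',
       tt)))) * (y' == c)%:R)
   * (y == y')%:R.
  rewrite !entE entZ ent_congruence /= ent1 ent_max_ent -/a.
  rewrite mulr_suml !mulr_sumr sum_unit; apply: eq_bigr => c _.
  rewrite sum_unit !(mulr_sumr, mulr_suml); apply: eq_bigr => c' _.
  rewrite !entE /= ent_max_ent -/a conj_leak !rmorphM /= !conjC_nat.
rewrite [c == y']eq_sym; ring.
under eq_bigr do under eq_bigr do rewrite E.
under eq_bigr do rewrite sum_delta sum_delta.
by rewrite -mulr_suml trace_leak mul0r.
Qed.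
End Attack.

Lemma card_le1_eq (C : finType) : (#|C| <= 1)%N -> forall c c' : C, c = c'.
Proof. by move=> /card_le1_eqP h c c'; apply: h. Qed.

Lemma binary_entropy0 (R : realType) : binary_entropy (0 : R) = 0.
Proof. by rewrite /binary_entropy /log2 subr0 ln1 !mul0r mulr0 oppr0 addr0. Qed.

(** * From non-malleability to secrecy *)

Section Final.
Variables (R : realType) (A C K : finType) (Q : qes R A C K).

Lemma ciphertext_factor (B : finType) (rho : op R (A * B)) :
  NM Q -> (1 < #|C|)%N -> state rho -> exists f g, forall c b c' b',
  ent (ptr2 (encrypt Q rho)) (c, b) (c', b') = f c c' * g b b'.
Proof.
move=> nm C2 [prho trho].
(* The side information is made trivial, and the register [B] of [rho] takes the role of the
   reference R. *)
pose rho' := relabel (fun p : A * unit * B => (p.1.1, p.2)) rho.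
have srho' : state rho'.
  split; first exact: psd_relabel.
  rewrite -trho !trE !sum_prod; apply: eq_bigr => a _.
  by rewrite big_unit_type; apply: eq_bigr => b _; rewrite entE.
have := nm unit (C * C)%type B rho' (@attack R C) srho' (cptp_attack R C2).
rewrite p_eq_attack // binary_entropy0 addr0.
rewrite (mutual_info_factor (X := swap23 rho')
  (f := fun p q => ent rho (p.1, p.2) (q.1, q.2)) (g := fun _ _ => 1)); first last.
- by move=> [a b] u [a' b'] u'; rewrite !entE mulr1.
- split; last by rewrite trace_swap23 (proj2 srho').
  by apply: (completely_positive_psd (@completely_positive_swap23 _ _ _ _));
    case: srho'.
set w := swap23 _ => Iw.
have pE := completely_positive_effective Q (cptp_attack R C2).
have sw : state w.
  split.
    apply: (completely_positive_psd (@completely_positive_swap23 _ _ _ _)).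
    by apply: (pE B); case: srho'.
  rewrite trace_swap23 trace_ext; first by case: srho'.
  exact: (trace_effective Q (cptp_attack R C2)).
have wE := mutual_info_le0 sw Iw.
(* The reduced operator of [w] on the reference register. *)
pose m u u' := \sum_a ent (ptr2 w) (a, u) (a, u').
pose N := #|C|%:R - #|C|%:R^-1 : R[i].
(* The left side is, up to [N], an entry of [w] with the plaintext traced out; since [w] is a
   product, its dependence on [u], [u'] separates. *)
have key s t b u u' : s != t ->
    \sum_c ent (ptr2 (encrypt Q rho)) (t, u) (c, u') * leak R (s, b) (c, tt) =
    N * ent (ptr1 w) (s, t) b * m u u'.
  move=> st.
  pose X := mkop (fun p q => ent rho' (p, u) (q, u')).
  transitivity (N * \sum_a ent (effective Q (@attack R C) X) (a, (s, t)) (a, b)).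
    rewrite sum_effective sum_attack // mulrA divff ?mul1r;
      last by rewrite gt_eqF // card_subV_gt0.
    apply: eq_bigr => c _; congr (_ * _); apply: ent_ptr2_encrypt_block.
    by move=> a a'; rewrite !entE.
  rewrite -mulrA; congr (_ * _); rewrite mulr_sumr; apply: eq_bigr => a _.
  transitivity (ent w ((a, u), (s, t)) ((a, u'), b)); first by rewrite !entE.
  by rewrite [in LHS]wE entE mulrC.
(* With [b = (s, t)], row [s] of [K_(s,t)] is the basis row [t], which isolates the term [c = t]. *)
have diag s t u u' : s != t -> ent (ptr2 (encrypt Q rho)) (t, u) (t, u') =
    N * ent (ptr1 w) (s, t) (s, t) * m u u'.
  move=> st; rewrite -key // -(sum_delta t
    (fun c => ent (ptr2 (encrypt Q rho)) (t, u) (c, u'))).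
  by apply: eq_bigr => c _; rewrite /leak /= eqxx mul1r (negbTE st) mulr0 mul0r
    subr0.
(* With [b = (s, s)], row [s] of [K_(s,s)] is 1 - 1/n times the basis row [s], and this factor is
   nonzero since n is at least 2. *)
have offdiag s t u u' : s != t -> ent (ptr2 (encrypt Q rho)) (t, u) (s, u') =
    N * ent (ptr1 w) (s, t) (s, s) / (1 - #|C|%:R^-1) * m u u'.
  move=> st; have C1 : 1 - #|C|%:R^-1 != 0 :> R[i].
    by rewrite subr_eq0 eq_sym invr_eq1 pnatr_eq1 gtn_eqF.
  apply: (mulIf C1); rewrite mulrAC divfK // -key //.
  rewrite -(sum_delta s
    (fun c => ent (ptr2 (encrypt Q rho)) (t, u) (c, u') * (1 - #|C|%:R^-1))).
  apply: eq_bigr => c _; rewrite /leak /= eqxx mulr1n; ring.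
(* A diagonal entry needs some [s] different from [t], chosen from [t] alone so that the first
   factor is free of [u] and [u']. The default [t] never occurs, as n is at least 2. *)
pose other (t : C) := odflt t [pick s | s != t].
have otherP t : other t != t.
  rewrite /other; case: pickP => //= all_t; have := C2; rewrite ltnNge => /negP[].
  by apply/card_le1_eqP => x y _ _; move/negbFE/eqP: (all_t x) => ->;
    move/negbFE/eqP: (all_t y) => ->.
exists (fun t s => if s == t then N * ent (ptr1 w) (other t, t) (other t, t)
  else N * ent (ptr1 w) (s, t) (s, s) / (1 - #|C|%:R^-1)), m => t u s u'.
have [->|st] := eqVneq s t; first exact: (diag _ _ _ _ (otherP t)).
exact: offdiag.
Qed.
End Final.

Theorem proposition5p15 (R : realType) (A C K : finType) (Q : qes R A C K) :
  NM Q -> ITS Q.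
Proof.
move=> nm B rho srho.
have ss : state (ptr2 (encrypt Q rho)).
  case: (srho) => pr tr; split; last by rewrite trace_ptr2 trace_encrypt.
  exact/psd_ptr2/(completely_positive_psd (completely_positive_encrypt Q (B := B))).
have [C1|C2] := leqP #|C| 1; last first.
  have [f [g fg]] := ciphertext_factor nm C2 srho.
  exact: mutual_info_factor fg.
(* An empty ciphertext basis would force trace 0. With a single basis vector every ciphertext index
   is [c0], and the constant 1 serves as first factor. *)
have [c0 _|C0] := pickP C; last first.
  have := ss.2; rewrite trE sum_prod big1 => [/esym/eqP|c _];
    first by rewrite oner_eq0.
  by have := C0 c.
apply: (mutual_info_factor (f := fun _ _ => 1)
  (g := fun b b' => ent (ptr2 (encrypt Q rho)) (c0, b) (c0, b'))) => // c b c' b'.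
by rewrite mul1r (card_le1_eq C1 c c0) (card_le1_eq C1 c' c0).
Qed.
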